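(* The logic $\mathsf{GS4}$ has the finite model property: for every formula $\varphi$, if $\mathsf{GS4}\nvdash\varphi$, then there is a $\mathsf{GS4}$-model $\mathcal M$ with finitely many worlds such that $\mathcal M\not\models\varphi$.
   Context: Fix a countably infinite set $\mathbb P$ of propositional variables. Formulas: $\varphi,\psi ::= p\mid\bot\mid(\varphi\wedge\psi)\mid(\varphi\vee\psi)\mid(\varphi\to\psi)\mid\Diamond\varphi\mid\Box\varphi$; $\neg\varphi:=\varphi\to\bot$. A bi-intuitionistic frame is $(W,W_\bot,\preccurlyeq,\sqsubseteq)$ with $\preccurlyeq,\sqsubseteq$ preorders on $W$ and $W_\bot\subseteq W$ upward closed under both; infallible if $W_\bot=\varnothing$. A valuation $V:\mathbb P\to 2^W$ has each $V(p)$ upward closed under $\preccurlyeq$ and containing $W_\bot$; a model is $\mathcal M=(W,W_\bot,\preccurlyeq,\sqsubseteq,V)$. Satisfaction: $p$ iff $w\in V(p)$; $\bot$ iff $w\in W_\bot$; $\wedge,\vee$ pointwise; $w\models\varphi\to\psi$ iff for all $v\succcurlyeq w$, $v\models\varphi$ implies $v\models\psi$; $w\models\Diamond\varphi$ iff for all $u\succcurlyeq w$ there is $v\sqsupseteq u$ with $v\models\varphi$; $w\models\Box\varphi$ iff $v\models\varphi$ whenever $w\preccurlyeq u\sqsubseteq v$. $\mathcal M\models\varphi$ iff $\varphi$ holds at every $w\in W\setminus W_\bot$. $\sqsubseteq$ is forward confluent if $w\preccurlyeq w'$ and $w\sqsubseteq v$ imply some $v'$ with $v\preccurlyeq v'$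 and $w'\sqsubseteq v'$; backward confluent if $w\sqsubseteq v\preccurlyeq v'$ implies some $w'$ with $w\preccurlyeq w'\sqsubseteq v'$. The frame is locally linear if $w\preccurlyeq u$ and $w\preccurlyeq v$ imply $u\preccurlyeq v$ or $v\preccurlyeq u$. A $\mathsf{GS4}$-frame is an infallible, locally linear bi-intuitionistic frame in which $\sqsubseteq$ is forward and backward confluent; a $\mathsf{GS4}$-model is a model on such a frame. $\mathsf{CS4}$ is the least set of formulas containing all intuitionistic propositional tautologies and all instances of $\Box(\varphi\to\psi)\to(\Box\varphi\to\Box\psi)$, $\Box(\varphi\to\psi)\to(\Diamond\varphi\to\Diamond\psi)$, $\Box\varphi\to\varphi$, $\varphi\to\Diamond\varphi$, $\Box\varphi\to\Box\Box\varphi$, $\Diamond\Diamond\varphi\to\Diamond\varphi$, closed under modus ponens and necessitation. $\mathsf{GS4}$ is $\mathsf{CS4}$ extended with all instances of $(\Diamond\varphi\to\Box\psi)\to\Box(\varphi\to\psi)$, $\Diamond(\varphi\vee\psi)\to\Diamond\varphi\vee\Diamond\psi$, $\neg\Diamond\bot$, and $(\varphi\to\psi)\vee(\psi\to\varphi)$ (closed under the same rules). *)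

(* Defs.v *)
From mathcomp Require Import all_boot.
Set Implicit Arguments.
Unset Strict Implicit.
Unset Printing Implicit Defensive.

Inductive form : Type :=
| Var : nat -> form
| Bot : form
| And : form -> form -> form
| Or  : form -> form -> form
| Imp : form -> form -> form
| Dia : form -> form
| Box : form -> form.

Definition Neg (a : form) : form := Imp a Bot.

Fixpoint modal_free (a : form) : Prop :=
  match a with
  | Var _ | Bot => True
  | And a b | Or a b | Imp a b => modal_free a /\ modal_free b
  | Dia _ | Box _ => False
  end.

Fixpoint isat (W : Type) (R : W -> W -> Prop) (V : nat -> W -> Prop)
  (w : W) (a : form) : Prop :=
  match a with
  | Var p => V p w
  | Bot => False
  | And a b => isat R V w a /\ isat R V w b
  | Or a b => isat R V w a \/ isat R V w b
  | Imp a b => forall v, R w v -> isat R V v a -> isat R V v b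
  | Dia a => False
  | Box a => False
  end.

Definition is_preorder (W : Type) (R : W -> W -> Prop) : Prop :=
  (forall w, R w w) /\ (forall u v w, R u v -> R v w -> R u w).

Definition ipc_valid (a : form) : Prop :=
  modal_free a /\
  forall (W : Type) (R : W -> W -> Prop) (V : nat -> W -> Prop),
    is_preorder R ->
    (forall p u v, R u v -> V p u -> V p v) ->
    forall w, isat R V w a.

Fixpoint subst (s : nat -> form) (a : form) : form :=
  match a with
  | Var p => s p
  | Bot => Bot
  | And a b => And (subst s a) (subst s b)
  | Or a b => Or (subst s a) (subst s b)
  | Imp a b => Imp (subst s a) (subst s b)
  | Dia a => Dia (subst s a)
  | Box a => Box (subst s a)
  end.

Definition ipc_taut (a : form) : Prop :=
  exists (b : form) (s : nat -> form), ipc_valid b /\ a = subst s b.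

Inductive GS4 : form -> Prop :=
| GS4_taut a : ipc_taut a -> GS4 a
| GS4_K a b : GS4 (Imp (Box (Imp a b)) (Imp (Box a) (Box b)))
| GS4_Kdia a b : GS4 (Imp (Box (Imp a b)) (Imp (Dia a) (Dia b)))
| GS4_T a : GS4 (Imp (Box a) a)
| GS4_Tdia a : GS4 (Imp a (Dia a))
| GS4_4 a : GS4 (Imp (Box a) (Box (Box a)))
| GS4_4dia a : GS4 (Imp (Dia (Dia a)) (Dia a))
| GS4_FS a b : GS4 (Imp (Imp (Dia a) (Box b)) (Box (Imp a b)))
| GS4_DP a b : GS4 (Imp (Dia (Or a b)) (Or (Dia a) (Dia b)))
| GS4_N : GS4 (Neg (Dia Bot))
| GS4_GD a b : GS4 (Or (Imp a b) (Imp b a))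
| GS4_MP a b : GS4 (Imp a b) -> GS4 a -> GS4 b
| GS4_Nec a : GS4 a -> GS4 (Box a).

Record model (W : Type) := Model {
  Wbot : W -> Prop;
  ple : W -> W -> Prop;
  sle : W -> W -> Prop;
  val : nat -> W -> Prop
}.

Definition bi_int_model (W : Type) (M : model W) : Prop :=
  is_preorder (ple M) /\ is_preorder (sle M) /\
  (forall u v, Wbot M u -> ple M u v -> Wbot M v) /\
  (forall u v, Wbot M u -> sle M u v -> Wbot M v) /\
  (forall p u v, ple M u v -> val M p u -> val M p v) /\
  (forall p u, Wbot M u -> val M p u).

Fixpoint sat (W : Type) (M : model W) (w : W) (a : form) : Prop :=
  match a with
  | Var p => val M p w
  | Bot => Wbot M w
  | And a b => sat M w a /\ sat M w b
  | Or a b => sat M w a \/ sat M w b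
  | Imp a b => forall v, ple M w v -> sat M v a -> sat M v b
  | Dia a => forall u, ple M w u -> exists v, sle M u v /\ sat M v a
  | Box a => forall u v, ple M w u -> sle M u v -> sat M v a
  end.

Definition model_valid (W : Type) (M : model W) (a : form) : Prop :=
  forall w, ~ Wbot M w -> sat M w a.

Definition forward_confluent (W : Type) (M : model W) : Prop :=
  forall w w' v, ple M w w' -> sle M w v ->
    exists v', ple M v v' /\ sle M w' v'.

Definition backward_confluent (W : Type) (M : model W) : Prop :=
  forall w v v', sle M w v -> ple M v v' ->
    exists w', ple M w w' /\ sle M w' v'.

Definition locally_linear (W : Type) (M : model W) : Prop :=
  forall w u v, ple M w u -> ple M w v -> ple M u v \/ ple M v u.

Definition infallible (W : Type) (M : model W) : Prop :=
  forall w, ~ Wbot M w.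

Definition GS4_model (W : Type) (M : model W) : Prop :=
  bi_int_model M /\ infallible M /\ locally_linear M /\
  forward_confluent M /\ backward_confluent M.

(* Main.v *)
Require Import Defs.
From mathcomp Require Import all_boot.
From mathcomp Require Import boolp classical_sets.
From Stdlib Require List.
From Stdlib Require Import Relation_Operators.

Set Implicit Arguments.
Unset Strict Implicit.
Unset Printing Implicit Defensive.

(** In the canonical model, whose worlds are the prime theories ordered by
    inclusion, put [w # v] when [□a ∈ w] implies [a ∈ v] and [a ∈ v] implies
    [◇a ∈ w].  Let [Σ] be the finite set of subformulas of [phi] and send a world
    [w] to the set [L w] of all traces [v ∩ Σ], for [v] above [w].  By local
    linearity [L w] is a chain with least element [w ∩ Σ], and the worlds above [w]
    have as images exactly the final segments of this chain; hence [L] is a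
    bisimulation for inclusion.  The image of [L] is finite, and its second relation
    is the reflexive transitive closure of the image of [#].  Closing under
    transitivity is harmless: by [□a → □□a] and [◇◇a → ◇a], the formulas [□a] and
    [◇a] of [Σ] themselves travel along steps of [#]. *)

Local Open Scope classical_set_scope.

(** * Deduction from a set of assumptions *)

Lemma GS4_taut_inst (b a1 a2 a3 : form) : ipc_valid b ->
  GS4 (subst (fun n => match n with 0 => a1 | 1 => a2 | _ => a3 end) b).
Proof. by move=> vb; apply: GS4_taut; exists b; eexists; split; first exact: vb. Qed.

Lemma GS4_weak a b : GS4 (Imp a (Imp b a)).
Proof.
apply: (@GS4_taut_inst (Imp (Var 0) (Imp (Var 1) (Var 0))) a b Bot).
split=> //= W R V _ mono w v _ va u vu _; exact: mono vu va.
Qed.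

Lemma GS4_dist a b c :
  GS4 (Imp (Imp a (Imp b c)) (Imp (Imp a b) (Imp a c))).
Proof.
apply: (@GS4_taut_inst (Imp (Imp (Var 0) (Imp (Var 1) (Var 2)))
   (Imp (Imp (Var 0) (Var 1)) (Imp (Var 0) (Var 2)))) a b c).
split=> //= W R V [rR tR] mono w v _ vabc u vu uab t ut ta.
by apply: (vabc t) => //; [exact: tR vu ut | exact: uab].
Qed.

Lemma GS4_andI a b : GS4 (Imp a (Imp b (And a b))).
Proof.
apply: (@GS4_taut_inst (Imp (Var 0) (Imp (Var 1) (And (Var 0) (Var 1)))) a b Bot).
split=> //= W R V _ mono w v _ va u vu ub; split=> //; exact: mono vu va.
Qed.

Lemma GS4_andEl a b : GS4 (Imp (And a b) a).
Proof.
apply: (@GS4_taut_inst (Imp (And (Var 0) (Var 1)) (Var 0)) a b Bot).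
by split=> //= W R V _ mono w v _ [].
Qed.

Lemma GS4_andEr a b : GS4 (Imp (And a b) b).
Proof.
apply: (@GS4_taut_inst (Imp (And (Var 0) (Var 1)) (Var 1)) a b Bot).
by split=> //= W R V _ mono w v _ [].
Qed.

Lemma GS4_orIl a b : GS4 (Imp a (Or a b)).
Proof.
apply: (@GS4_taut_inst (Imp (Var 0) (Or (Var 0) (Var 1))) a b Bot).
by split=> //= W R V _ mono w v _ va; left.
Qed.

Lemma GS4_orIr a b : GS4 (Imp b (Or a b)).
Proof.
apply: (@GS4_taut_inst (Imp (Var 1) (Or (Var 0) (Var 1))) a b Bot).
by split=> //= W R V _ mono w v _ va; right.
Qed.

Lemma GS4_orE a b c :
  GS4 (Imp (Imp a c) (Imp (Imp b c) (Imp (Or a b) c))).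
Proof.
apply: (@GS4_taut_inst (Imp (Imp (Var 0) (Var 2))
   (Imp (Imp (Var 1) (Var 2)) (Imp (Or (Var 0) (Var 1)) (Var 2)))) a b c).
split=> //= W R V [rR tR] mono w v _ vac u vu ubc t ut [ta|tb].
- by apply: vac => //; exact: tR vu ut.
- exact: ubc.
Qed.

Lemma GS4_exfalso a : GS4 (Imp Bot a).
Proof.
apply: (@GS4_taut_inst (Imp Bot (Var 0)) a Bot Bot).
by split=> //= W R V _ _ w v _ [].
Qed.

Lemma GS4_refl a : GS4 (Imp a a).
Proof.
apply: GS4_MP (GS4_weak a a).
by apply: GS4_MP (GS4_weak a (Imp a a)); exact: GS4_dist.
Qed.

(** Necessitation enters only through theorems, so the deduction theorem [ded_imp] holds. *)
Inductive ded (G : set form) : form -> Prop :=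
| ded_thm a : GS4 a -> ded G a
| ded_ax a : G a -> ded G a
| ded_mp a b : ded G (Imp a b) -> ded G a -> ded G b.

Lemma ded_thm_mp G a b : GS4 (Imp a b) -> ded G a -> ded G b.
Proof. by move=> ab; apply: ded_mp; exact: ded_thm. Qed.

Lemma ded_mono (G H : set form) a : G `<=` H -> ded G a -> ded H a.
Proof.
move=> GH; elim=> {a} [a|a /GH|a b _ IHab _ IHa].
- exact: ded_thm.
- exact: ded_ax.
- exact: ded_mp IHab IHa.
Qed.

Lemma ded_set0 a : ded set0 a -> GS4 a.
Proof. by elim=> {a} // a b _ ab _ a0; exact: GS4_MP ab a0. Qed.

Lemma ded_imp G a b : ded (G `|` [set a]) b -> ded G (Imp a b).
Proof.
elim=> {b} [b tb|b [Gb|->]|b c _ IHbc _ IHb].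
- by apply: ded_thm_mp (ded_thm G tb); exact: GS4_weak.
- by apply: ded_thm_mp (ded_ax Gb); exact: GS4_weak.
- by apply: ded_thm; exact: GS4_refl.
- by apply: ded_mp IHb; apply: ded_thm_mp IHbc; exact: GS4_dist.
Qed.

Lemma ded_imp_trans G a b c :
  ded G (Imp a b) -> ded G (Imp b c) -> ded G (Imp a c).
Proof.
move=> ab bc; apply: ded_imp.
have sub : G `<=` G `|` [set a] by left.
apply: ded_mp (ded_mono sub bc) _.
by apply: ded_mp (ded_mono sub ab) _; apply: ded_ax; right.
Qed.

(** Directedness under provable implication stands in for closure under finite disjunctions here,
    and under finite conjunctions in [down_directed]. *)
Definition up_directed (D : set form) :=
  (exists d, D d) /\
  forall a b, D a -> D b ->
    exists c, [/\ D c, GS4 (Imp a c) & GS4 (Imp b c)].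

Definition down_directed (X : set form) :=
  (exists x, X x) /\
  forall a b, X a -> X b ->
    exists c, [/\ X c, GS4 (Imp c a) & GS4 (Imp c b)].

Lemma up_directed1 a : up_directed [set a].
Proof.
split; first by exists a.
by move=> _ _ -> ->; exists a; split=> //; exact: GS4_refl.
Qed.

Lemma down_directed1 a : down_directed [set a].
Proof.
split; first by exists a.
by move=> _ _ -> ->; exists a; split=> //; exact: GS4_refl.
Qed.

(** A derivation uses finitely many members of [X], and by directedness a single [x] implies them
    all. *)
Lemma ded_setU_down_directed (G X : set form) a : down_directed X ->
  ded (G `|` X) a -> exists2 x, X x & ded G (Imp x a).
Proof.
move=> [[x0 Xx0] dirX]; elim=> {a} [a ta|a [Ga|Xa]|a b _ [x Xx xab] _ [y Xy ya]].
- by exists x0 => //; apply: ded_thm_mp (ded_thm G ta); exact: GS4_weak.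
- by exists x0 => //; apply: ded_thm_mp (ded_ax Ga); exact: GS4_weak.
- by exists a => //; apply: ded_thm; exact: GS4_refl.
- have [z [Xz zx zy]] := dirX _ _ Xx Xy; exists z => //.
  apply: ded_mp (ded_imp_trans (ded_thm G zy) ya).
  by apply: ded_thm_mp (ded_imp_trans (ded_thm G zx) xab); exact: GS4_dist.
Qed.

(** A derivation meets finitely many members of the chain, and the largest of them suffices. The
    first alternative covers derivations that meet none, as when [F] is empty. *)
Lemma ded_chain (G : set form) (F : set (set form)) a : total_on F subset ->
  ded (G `|` \bigcup_(X in F) X) a ->
  ded G a \/ exists2 X, F X & ded (G `|` X) a.
Proof.
move=> totF; elim=> {a} [a ta|a [Ga|[X FX Xa]]|a b _ IHab _ IHa].
- by left; exact: ded_thm.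
- by left; exact: ded_ax.
- by right; exists X => //; apply: ded_ax; right.
- have GX X : G `<=` G `|` X by left.
  have XY X Y : X `<=` Y -> G `|` X `<=` G `|` Y by move=> XY x [|/XY]; [left|right].
  case: IHab IHa => [ab|[X FX ab]] [a0|[Y FY a0]].
  + by left; exact: ded_mp ab a0.
  + by right; exists Y => //; apply: ded_mp a0; apply: ded_mono ab.
  + by right; exists X => //; apply: ded_mp ab _; apply: ded_mono a0.
  + have [/XY sub|/XY sub] := totF _ _ FX FY; right; [exists Y|exists X] => //.
      by apply: ded_mp a0; apply: ded_mono ab.
    by apply: ded_mp ab _; apply: ded_mono a0.
Qed.

(** * Prime theories *)

Record theory := Theory {
  mem_theory :> form -> Prop;
  theory_ded : forall a, ded mem_theory a -> mem_theory a;
  theory_consistent : ~ mem_theory Bot;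
  theory_prime : forall a b,
    mem_theory (Or a b) -> mem_theory a \/ mem_theory b }.

Lemma theory_mp (w : theory) a b : w (Imp a b) -> w a -> w b.
Proof. by move=> ab wa; apply/theory_ded/ded_mp; apply: ded_ax; [exact: ab|]. Qed.

Lemma theory_thm (w : theory) a : GS4 a -> w a.
Proof. by move=> ta; apply/theory_ded/ded_thm. Qed.

Lemma theory_thm_mp (w : theory) a b : GS4 (Imp a b) -> w a -> w b.
Proof. by move=> /(theory_thm w); exact: theory_mp. Qed.

(** Zorn's lemma gives a maximal extension deriving no member of [D]. Directedness yields primeness:
    if both disjuncts were missing, each would imply a member of [D], and their disjunction a common
    upper bound. *)
Lemma lindenbaum (G D : set form) : up_directed D ->
  (forall d, D d -> ~ ded G d) ->
  exists w : theory, G `<=` w /\ forall d, D d -> ~ w d.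
Proof.
move=> [[d0 Dd0] dirD] GD.
(* [G] is kept outside [A], so that the union of the empty chain also satisfies [P]. *)
pose P (A : set form) := forall d, D d -> ~ ded (G `|` A) d.
have [|A [PA maxA]] := @Zorn_bigcup form P.
  move=> F FP totF d Dd /(ded_chain totF) [|[X FX]]; first exact: GD.
  by move: (FP _ FX); apply.
pose T := G `|` A.
have maxT a : ~ T a -> exists2 d, D d & ded T (Imp a d).
  move=> nTa; apply: contrapT => no_d.
  apply: (maxA (A `|` [set a])).
    split=> [x Ax|sub]; first by left.
    by apply: nTa; right; apply: sub; right.
  move=> d Dd; rewrite setUA => /ded_imp ad.
  by apply: no_d; exists d.
have Tded a : ded T a -> T a.
  move=> da; apply: contrapT => /maxT[d Dd ad].
  exact: (PA _ Dd (ded_mp ad da)).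
have Tbot : ~ T Bot.
  move=> TB; apply: (PA _ Dd0).
  by apply: ded_thm_mp (ded_ax TB); exact: GS4_exfalso.
have Tprime a b : T (Or a b) -> T a \/ T b.
  move=> Tab; apply: contrapT => /not_orP[/maxT[d Dd ad] /maxT[e De be]].
  have [c [Dc dc ec]] := dirD _ _ Dd De.
  apply: (PA _ Dc).
  apply: (ded_mp _ (ded_ax Tab)).
  apply: ded_mp (ded_imp_trans be (ded_thm _ ec)).
  by apply: ded_thm_mp (ded_imp_trans ad (ded_thm _ dc)); exact: GS4_orE.
exists (Theory Tded Tbot Tprime); split=> [a Ga|d Dd Td]; first by left.
exact: (PA _ Dd (ded_ax Td)).
Qed.

Definition accessible (w v : theory) :=
  (forall a, w (Box a) -> v a) /\ (forall a, v a -> w (Dia a)).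

Lemma theory_linear (w u v : theory) :
  w `<=` u -> w `<=` v -> u `<=` v \/ v `<=` u.
Proof.
move=> wu wv; apply: contrapT => /not_orP[].
move=> /existsNP[a /not_implyP[ua nva]] /existsNP[b /not_implyP[vb nub]].
have [/wu ab|/wv ba] := theory_prime (theory_thm w (GS4_GD a b)).
- exact: nub (theory_mp ab ua).
- exact: nva (theory_mp ba vb).
Qed.

(** * Witnesses and confluence in the canonical model *)

Definition unbox (w : theory) : set form := [set a | w (Box a)].

Lemma ded_unbox (w : theory) a : ded (unbox w) a -> w (Box a).
Proof.
elim=> {a} [a ta|//|a b _ IHab _ IHa].
- by apply: theory_thm; exact: GS4_Nec.
- by apply: theory_mp IHa; apply: theory_thm_mp IHab; exact: GS4_K.
Qed.

Lemma GS4_box_mono a b : GS4 (Imp a b) -> GS4 (Imp (Box a) (Box b)).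
Proof. by move=> /GS4_Nec; apply: GS4_MP; exact: GS4_K. Qed.

Lemma GS4_dia_mono a b : GS4 (Imp a b) -> GS4 (Imp (Dia a) (Dia b)).
Proof. by move=> /GS4_Nec; apply: GS4_MP; exact: GS4_Kdia. Qed.

(** [GS4_N] makes the set nonempty, and [GS4_DP] with primeness closes it under disjunction, so
    [lindenbaum] can avoid all of it at once. *)
Lemma up_directed_not_dia (w : theory) : up_directed [set a | ~ w (Dia a)].
Proof.
split.
  exists Bot => wB; apply: (@theory_consistent w).
  by apply: theory_thm_mp wB; exact: GS4_N.
move=> a b /= na nb; exists (Or a b); split; [|exact: GS4_orIl|exact: GS4_orIr].
by move=> /(theory_thm_mp (@GS4_DP a b))/theory_prime[].
Qed.

Lemma down_directed_theory (w : theory) : down_directed w.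
Proof.
split; first by exists (Imp Bot Bot); apply: theory_thm; exact: GS4_exfalso.
move=> a b wa wb; exists (And a b).
split; [|exact: GS4_andEl|exact: GS4_andEr].
by apply: theory_mp wb; apply: theory_thm_mp wa; exact: GS4_andI.
Qed.

Lemma imp_witness (w : theory) a b : ~ w (Imp a b) ->
  exists v : theory, [/\ w `<=` v, v a & ~ v b].
Proof.
move=> nab.
have [|v [sub avoid]] := @lindenbaum (w `|` [set a]) _ (up_directed1 b).
  by move=> _ -> /ded_imp /theory_ded.
exists v; split; last exact: avoid.
- by move=> c wc; apply: sub; left.
- by apply: sub; right.
Qed.

(** Common source of diamond witnesses and forward confluence. The theory extends [unbox w'] and [X]
    and avoids every [d] with [Dia d] outside [w']; if some [x] in [X] led to such a [d], [GS4_Kdia]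
    would put [Dia d] in [w']. *)
Lemma accessible_extend (w' : theory) (X : set form) :
  down_directed X -> (forall x, X x -> w' (Dia x)) ->
  exists v' : theory, X `<=` v' /\ accessible w' v'.
Proof.
move=> dirX Xdia.
have [|v [sub avoid]] := @lindenbaum (unbox w' `|` X) _ (up_directed_not_dia w').
  move=> d /= nd /(ded_setU_down_directed dirX)[x Xx /ded_unbox wxd].
  apply: nd; apply: theory_mp (Xdia _ Xx).
  by apply: theory_thm_mp wxd; exact: GS4_Kdia.
exists v; split; first by move=> x Xx; apply: sub; right.
split=> a.
- by move=> wa; apply: sub; left.
- by move=> va; apply: contrapT => nwa; exact: avoid nwa va.
Qed.

Lemma dia_witness (w : theory) a : w (Dia a) ->
  exists v : theory, accessible w v /\ v a.
Proof.
move=> wa; have [_ -> //|v [sub acc]] := @accessible_extend w _ (down_directed1 a).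
by exists v; split=> //; exact: sub.
Qed.

Lemma accessible_forward (w w' v : theory) : w `<=` w' -> accessible w v ->
  exists v' : theory, v `<=` v' /\ accessible w' v'.
Proof.
move=> ww' [_ vdia]; apply: accessible_extend; first exact: down_directed_theory.
by move=> x /vdia /ww'.
Qed.

(** Core of backward confluence. The theory [u] must contain [w] and each [Dia b] with [b] in [v],
    and avoid each [Box c] with [c] outside [v]; the last two demands are exactly
    [accessible u v]. *)
Lemma accessible_of_unbox (w v : theory) : unbox w `<=` v ->
  exists u : theory, w `<=` u /\ accessible u v.
Proof.
move=> wv.
pose X : set form := [set Dia b | b in v].
pose D : set form := [set Box c | c in [set c | ~ v c]].
have dirX : down_directed X.
  have [[x vx] dirv] := down_directed_theory v.
  split; first by exists (Dia x); exists x.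
  move=> _ _ [a va <-] [b vb <-]; have [c [vc ca cb]] := dirv _ _ va vb.
  by exists (Dia c); split; [exists c|exact: GS4_dia_mono|exact: GS4_dia_mono].
have dirD : up_directed D.
  split; first by exists (Box Bot); exists Bot => //; exact: theory_consistent.
  move=> _ _ [a va <-] [b vb <-]; exists (Box (Or a b)); split.
  - by exists (Or a b) => // /theory_prime[].
  - by apply: GS4_box_mono; exact: GS4_orIl.
  - by apply: GS4_box_mono; exact: GS4_orIr.
have [|u [sub avoid]] := @lindenbaum (w `|` X) _ dirD.
  (* Otherwise [w] contains [Imp (Dia b) (Box c)], hence [Box (Imp b c)] by [GS4_FS], which forces
     [c] into [v]. *)
  move=> _ [c nvc <-] /(ded_setU_down_directed dirX)[_ [b vb <-] /theory_ded wbc].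
  apply: nvc; apply: theory_mp vb; apply: wv.
  by apply: theory_thm_mp wbc; exact: GS4_FS.
exists u; split; first by move=> a wa; apply: sub; left.
split=> a.
- by move=> ua; apply: contrapT => nva; apply: avoid ua; exists a.
- by move=> va; apply: sub; right; exists a.
Qed.

(** The refuting [v] is chosen first, above [unbox w]; the intermediate [u] is then fitted to it. *)
Lemma box_witness (w : theory) a : ~ w (Box a) ->
  exists u v : theory, [/\ w `<=` u, accessible u v & ~ v a].
Proof.
move=> nwa.
have [|v [sub avoid]] := @lindenbaum (unbox w) _ (up_directed1 a).
  by move=> _ -> /ded_unbox.
have [u [wu uv]] := accessible_of_unbox sub.
by exists u, v; split=> //; exact: avoid.
Qed.

Lemma accessible_backward (w v v' : theory) : accessible w v -> v `<=` v' ->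
  exists w' : theory, w `<=` w' /\ accessible w' v'.
Proof. by move=> [box _] vv'; apply: accessible_of_unbox => a /box /vv'. Qed.

(** * Finite quotients of the canonical model *)

Fixpoint subformulas (a : form) : seq form :=
  a :: match a with
       | Var _ | Bot => [::]
       | And a b | Or a b | Imp a b => subformulas a ++ subformulas b
       | Dia a | Box a => subformulas a
       end.

(** * Quotient along an abstract map that respects [Sigma] and lifts inclusions *)

Section Quotient.

Variables (W : Type) (cls : theory -> W).
Variable Sigma : form -> Prop.

Hypothesis cls_surj : forall c, exists w, cls w = c.
Hypothesis cls_agree : forall w v : theory, cls w = cls v ->
  forall a, Sigma a -> w a -> v a.
Hypothesis cls_bisim : forall w v w' : theory, cls w = cls v -> w `<=` w' ->
  exists v' : theory, v `<=` v' /\ cls v' = cls w'.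

Definition qle (c d : W) :=
  exists w v : theory, [/\ cls w = c, cls v = d & w `<=` v].

Definition qstep (c d : W) :=
  exists w v : theory, [/\ cls w = c, cls v = d & accessible w v].

(** Consecutive steps may use different representatives of the middle class, so [qstep] need not
    compose; the closure restores transitivity. *)
Definition qmodel : model W := Model (fun _ => False) qle
  (clos_refl_trans W qstep)
  (fun p c => exists w : theory, [/\ cls w = c, w (Var p) & Sigma (Var p)]).

(** By [cls_bisim] the larger theory can be found above any prescribed representative. *)
Lemma qleP (w : theory) d :
  qle (cls w) d -> exists v : theory, w `<=` v /\ cls v = d.
Proof.
by move=> [w1 [v1 [/cls_bisim e <- /e]]].
Qed.

Lemma qle_cls (w v : theory) : w `<=` v -> qle (cls w) (cls v).
Proof. by move=> wv; exists w, v. Qed.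

Lemma qstep_cls (w v : theory) : accessible w v -> qstep (cls w) (cls v).
Proof. by move=> wv; exists w, v. Qed.

(** Squares for single steps come from the canonical model and are pasted along the closure. *)
Lemma qmodel_forward : forward_confluent qmodel.
Proof.
move=> c c' d /= cc' cd; elim: cd c' cc' => {c d}
  [_ _ [w [v [<- <- wv]]]|c|c d e _ IHcd _ IHde] c'.
- move=> /qleP[w' [ww' <-]].
  have [v' [vv' wv']] := accessible_forward ww' wv.
  by exists (cls v'); split; [exact: qle_cls|apply/rt_step/qstep_cls].
- by exists c'; split=> //; exact: rt_refl.
- move=> /IHcd[d' [/IHde[e' [ee' de']] cd']]; exists e'; split=> //.
  by apply: rt_trans de'.
Qed.

Lemma qmodel_backward : backward_confluent qmodel.
Proof.
move=> c d d' /= cd; elim: cd d' => {c d}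
  [_ _ [w [v [<- <- wv]]]|c|c d e _ IHcd _ IHde] d'.
- move=> /qleP[v' [vv' <-]].
  have [w' [ww' wv']] := accessible_backward wv vv'.
  by exists (cls w'); split; [exact: qle_cls|apply/rt_step/qstep_cls].
- by exists d'; split=> //; exact: rt_refl.
- move=> /IHde[d1 [/IHcd[c' [cc' cd']] de']]; exists c'; split=> //.
  by apply: rt_trans de'.
Qed.

Lemma qmodel_GS4 : GS4_model qmodel.
Proof.
split; last split; [|by move=> c []|split];
  last by split; [exact: qmodel_forward|exact: qmodel_backward].
- split; last split; last do 3! [split=> //].
  + split=> [c|c d e]; first by have [w <-] := cls_surj c; exact: qle_cls.
    move=> [w [v [<- <- wv]]] /qleP[u [vu <-]].
    by apply: qle_cls => a /wv /vu.
  + by split=> [c|c d e]; [exact: rt_refl|exact: rt_trans].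
  + move=> p c d cd [w [wc wp Sp]]; move: cd; rewrite -wc => /qleP[v [wv <-]].
    by exists v; split=> //; exact: wv.
(* Both successors are lifted above the same representative [w], where [theory_linear] applies. *)
- move=> c d e /= [w [v [<- <- wv]]] /qleP[u [wu <-]].
  by have [vu|uv] := theory_linear wv wu; [left|right]; exact: qle_cls.
Qed.

(** A change of representative preserves only formulas of [Sigma], so [Box a] itself is carried
    along; inside a step, [GS4_4] first turns it into [Box (Box a)]. *)
Lemma qsteps_box (c d : W) (w v : theory) a : Sigma (Box a) ->
  clos_refl_trans W qstep c d -> cls w = c -> cls v = d -> w (Box a) -> v (Box a).
Proof.
move=> Sa cd; elim: cd w v => {c d}
  [_ _ [w1 [v1 [<- <- [box _]]]]|c|c d e _ IHcd _ IHde] w v.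
- move=> ww1 /esym vv1 wa.
  apply: (cls_agree vv1 Sa); apply: box.
  by apply: theory_thm_mp (cls_agree ww1 Sa wa); exact: GS4_4.
- by move=> <- /esym /cls_agree; apply.
- move=> wc ve wa; have [u ud] := cls_surj d.
  by apply: (IHde u v) => //; exact: IHcd wa.
Qed.

(** Dual to [qsteps_box], with [Dia a] travelling backwards by [GS4_4dia]. *)
Lemma qsteps_dia (c d : W) (w v : theory) a : Sigma (Dia a) ->
  clos_refl_trans W qstep c d -> cls w = c -> cls v = d -> v (Dia a) -> w (Dia a).
Proof.
move=> Sa cd; elim: cd w v => {c d}
  [_ _ [w1 [v1 [<- <- [_ dia]]]]|c|c d e _ IHcd _ IHde] w v.
- move=> /esym ww1 vv1 va.
  apply: (cls_agree ww1 Sa); apply: (theory_thm_mp (GS4_4dia a)).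
  exact/dia/(cls_agree vv1 Sa).
- by move=> <- /cls_agree; apply.
- move=> wc ve va; have [u ud] := cls_surj d.
  by apply: (IHcd w u) => //; exact: IHde va.
Qed.

Lemma qmodel_truth (a : form) : (forall b, List.In b (subformulas a) -> Sigma b) ->
  forall w : theory, sat qmodel (cls w) a <-> w a.
Proof.
elim: a => [p| |a IHa b IHb|a IHa b IHb|a IHa b IHb|a IHa|a IHa] /= sub w.
- have Sp : Sigma (Var p) by apply: sub; left.
  split=> [[v [/cls_agree vw vp _]]|wp]; first exact: vw.
  by exists w.
- by split=> //; exact: theory_consistent.
- have {}IHa v : sat qmodel (cls v) a <-> v a.
    by apply: IHa => c ?; apply: sub; right; apply: List.in_or_app; auto.
  have {}IHb v : sat qmodel (cls v) b <-> v b.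
    by apply: IHb => c ?; apply: sub; right; apply: List.in_or_app; auto.
  split=> [[/IHa wa /IHb wb]|wab].
    by apply: theory_mp wb; apply: theory_thm_mp wa; exact: GS4_andI.
  split; [apply/IHa|apply/IHb]; apply: theory_thm_mp wab.
    exact: GS4_andEl.
  exact: GS4_andEr.
- have {}IHa v : sat qmodel (cls v) a <-> v a.
    by apply: IHa => c ?; apply: sub; right; apply: List.in_or_app; auto.
  have {}IHb v : sat qmodel (cls v) b <-> v b.
    by apply: IHb => c ?; apply: sub; right; apply: List.in_or_app; auto.
  split=> [[/IHa|/IHb]|/theory_prime[/IHa|/IHb]]; [| |by left|by right].
    by apply: theory_thm_mp; exact: GS4_orIl.
  by apply: theory_thm_mp; exact: GS4_orIr.
- have {}IHa v : sat qmodel (cls v) a <-> v a.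
    by apply: IHa => c ?; apply: sub; right; apply: List.in_or_app; auto.
  have {}IHb v : sat qmodel (cls v) b <-> v b.
    by apply: IHb => c ?; apply: sub; right; apply: List.in_or_app; auto.
  split=> [wab|wab _ /qleP[v [wv <-]] /IHa va].
    apply: contrapT => /imp_witness[v [wv va nvb]].
    by apply/nvb/IHb/wab; [exact: qle_cls|exact/IHa].
  exact/IHb/(theory_mp (wv _ wab)).
- have {}IHa v : sat qmodel (cls v) a <-> v a by apply: IHa => c ?; apply: sub; right.
  have Sa : Sigma (Dia a) by apply: sub; left.
  split=> [wa|wa _ /qleP[u [wu <-]]].
    (* The clause is used at the world itself; at the endpoint [a] becomes [Dia a], which travels
       back to [w]. *)
    have [|d [wd]] := wa (cls w); first exact: qle_cls.
    have [v vd] := cls_surj d; rewrite -vd => /IHa va.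
    apply: (qsteps_dia Sa wd erefl vd).
    by apply: theory_thm_mp va; exact: GS4_Tdia.
  have [v [uv va]] := dia_witness (wu _ wa).
  by exists (cls v); split; [apply/rt_step/qstep_cls|exact/IHa].
- have {}IHa v : sat qmodel (cls v) a <-> v a by apply: IHa => c ?; apply: sub; right.
  have Sa : Sigma (Box a) by apply: sub; left.
  split=> [wa|wa _ d /qleP[u [wu <-]] ud].
    apply: contrapT => /box_witness[u [v [wu uv nva]]].
    apply/nva/IHa/(wa (cls u)); [exact: qle_cls|exact/rt_step/qstep_cls].
  (* [Box a] persists to [u], travels to [v], and only there is unboxed by [GS4_T]. *)
  have [v vd] := cls_surj d; rewrite -vd; apply/IHa.
  by apply: theory_thm_mp (qsteps_box Sa ud erefl vd (wu _ wa)); exact: GS4_T.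
Qed.

End Quotient.

(** * The finite quotient by chains of traces *)

Section Chain.

Variable S : seq form.

(** Formulas are encoded by their positions in [S], so that traces and sets of traces form finite
    types. *)
Definition trace (w : theory) : {set 'I_(size S)} :=
  [set i : 'I_(size S) | `[< w (nth Bot S i) >]]%SET.

Definition chain (w : theory) : {set {set 'I_(size S)}} :=
  [set t : {set 'I_(size S)} | `[< exists2 v : theory, w `<=` v & trace v = t >]]%SET.

Lemma chainP (w : theory) t :
  reflect (exists2 v : theory, w `<=` v & trace v = t) (t \in chain w).
Proof. by rewrite inE; exact: asboolP. Qed.

Lemma traceP (w : theory) (i : 'I_(size S)) :
  reflect (w (nth Bot S i)) (i \in trace w).
Proof. by rewrite inE; exact: asboolP. Qed.

Lemma trace_mono (w v : theory) : w `<=` v -> trace w \subset trace v.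
Proof.
move=> wv; apply/fintype.subsetP => i; move=> /traceP wi.
by apply/traceP; exact: wv.
Qed.

Lemma trace_in_chain (w : theory) : trace w \in chain w.
Proof. by apply/chainP; exists w. Qed.

(** The trace of [w] is the least element of its chain, so the chain determines it. *)
Lemma chain_trace (w v : theory) : chain w = chain v -> trace w \subset trace v.
Proof.
move=> e; have := trace_in_chain v; rewrite -e => /chainP[u wu <-].
exact: trace_mono.
Qed.

Lemma chain_agree (w v : theory) : chain w = chain v ->
  forall a, List.In a S -> w a -> v a.
Proof.
move=> /chain_trace /fintype.subsetP sub a Sa wa.
have [i iS ia] : exists2 i, i < size S & nth Bot S i = a.
  elim: {sub} S Sa => //= b s IHs [->|/IHs[i iS ia]]; first by exists 0.
  by exists i.+1.
have /sub /traceP /= : Ordinal iS \in trace w by apply/traceP; rewrite /= ia.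
by rewrite ia.
Qed.

Lemma chain_final (w v : theory) : w `<=` v ->
  chain v = [set t in chain w | trace v \subset t]%SET.
Proof.
move=> wv; apply/setP => t; rewrite [RHS]inE; apply/idP/andP.
- move=> /chainP[u vu <-]; split; last exact: trace_mono.
  by apply/chainP; exists u => // a /wv /vu.
- move=> [/chainP[u wu <-] vu]; have [sub|/trace_mono uv] := theory_linear wv wu.
    by apply/chainP; exists u.
  (* Here [u] lies below [v] although its trace lies above, so the traces coincide and [v] itself is
     the witness. *)
  suff -> : trace u = trace v by exact: trace_in_chain.
  by apply/eqP; rewrite finset.eqEsubset uv.
Qed.

(** By [chain_final], the chain of [w'] depends only on the chain of [w] and the trace of [w'], so
    any [v'] above [v] with that trace will do. *)
Lemma chain_bisim (w v w' : theory) : chain w = chain v -> w `<=` w' ->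
  exists v' : theory, v `<=` v' /\ chain v' = chain w'.
Proof.
move=> e ww'.
have : trace w' \in chain v by rewrite -e; apply/chainP; exists w'.
move=> /chainP[v' vv' tv']; exists v'; split=> //.
by rewrite (chain_final vv') (chain_final ww') e tv'.
Qed.

(** Only realised chains are kept, which makes [chain_cls] surjective. *)
Definition chain_world := {c | `[< exists w, chain w = c >]}.

Definition chain_cls (w : theory) : chain_world :=
  exist _ (chain w) (asboolT (ex_intro _ w erefl)).

Lemma chain_clsP (w v : theory) : chain_cls w = chain_cls v <-> chain w = chain v.
Proof. by split=> [[]|e]; last exact/val_inj. Qed.

Lemma chain_cls_surj c : exists w, chain_cls w = c.
Proof.
by case: c => c cP; have /asboolP[w wc] := cP; exists w; apply/val_inj.
Qed.

End Chain.

Theorem mainTheorem2 (phi : form) :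
  ~ GS4 phi ->
  exists (W : finType) (M : model W), GS4_model M /\ ~ model_valid M phi.
Proof.
move=> nphi; pose S := subformulas phi.
have agree (w v : theory) : chain_cls S w = chain_cls S v ->
    forall a, List.In a S -> w a -> v a.
  by move=> /chain_clsP/chain_agree.
have bisim (w v w' : theory) : chain_cls S w = chain_cls S v -> w `<=` w' ->
    exists v' : theory, v `<=` v' /\ chain_cls S v' = chain_cls S w'.
  move=> /chain_clsP /chain_bisim e /e[v' [vv' /chain_clsP vw']].
  by exists v'.
have surj := @chain_cls_surj S.
exists (chain_world S : finType), (qmodel (chain_cls S) (fun a => List.In a S)).
split; first exact: qmodel_GS4.
(* The class of a prime theory omitting [phi] is the refuting world. *)
have [|w [_ nw]] := @lindenbaum set0 _ (up_directed1 phi).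
  by move=> _ -> /ded_set0.
move=> valid; apply: (nw phi) => //.
by apply/(qmodel_truth surj agree bisim (a := phi)); [|exact: valid].
Qed.
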